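(* Let $W_{\mathbb Q}=\mathbb Q[\mathbb R_+^\times]$, let $\theta:W_{\mathbb Q}\to\mathbb R$ be the ring homomorphism $\theta(\sum_i a_i[x_i])=\sum_i a_ix_i$, and let $\mathbb R_\infty=\varprojlim_n W_{\mathbb Q}/\mathrm{Ker}(\theta)^n$. (i) Let $\ell:\mathbb R_+^\times\to\mathbb R$ be a group homomorphism. Then the map $$\mathcal T_\ell(X)(z):=\sum_i a_i e^{\log(x_i)+(z-1)\ell(x_i)},\qquad X=\sum_i a_i[x_i]\in W_{\mathbb Q}\quad (a_i\in\mathbb Q,\ x_i\in\mathbb R_+^\times),$$ defines a ring homomorphism $\mathcal T_\ell:W_{\mathbb Q}\to C^\infty(\mathbb R)$ to the ring of smooth real functions, and $\theta(X)=\mathcal T_\ell(X)(1)$ for all $X\in W_{\mathbb Q}$. (ii) The Taylor expansion at $z=1$ induces a ring homomorphism $\mathcal T_\ell:\mathbb R_\infty\to\mathbb R[[z-1]]$, which is surjective if $x\ell(x)+(1-x)\ell(|1-x|)\neq 0$ for some $x\in\mathbb R_+^\times$, $x\ne 1$. (iii) $\mathrm{Ker}(\theta)/\mathrm{Ker}(\theta)^2$ is an infinite dimensional real vector space, and the ''periods'' $\pi_p=[p]-p\in\mathrm{Ker}(\theta)/\mathrm{Ker}(\theta)^2$, for $p$ a prime number, are linearly independent over $\mathbb R$.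
   Context: $\mathbb R_+^\times$ is the multiplicative group of positive real numbers, $\mathbb Q[\mathbb R_+^\times]$ its rational group ring, and $[x]$ denotes the group-ring element associated to $x\in\mathbb R_+^\times$ (the symbol is extended to $\mathbb R$ by $[0]=0$, $[-x]=-[x]$). In $\pi_p=[p]-p$ the second term is the integer $p$, i.e. $p\cdot[1]$. The real vector space structure of $\mathrm{Ker}(\theta)/\mathrm{Ker}(\theta)^2$ comes from its structure of module over $W_{\mathbb Q}/\mathrm{Ker}(\theta)\cong\mathbb R$ (isomorphism induced by $\theta$). Group homomorphisms $\ell$ are from the multiplicative group $\mathbb R_+^\times$ to the additive group $\mathbb R$; no continuity is assumed. *)

(* Defs.v *)
From HB Require Import structures.
From mathcomp Require Import all_boot all_order all_algebra.
From mathcomp Require Import finmap.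
From mathcomp Require Import all_classical all_reals all_analysis.
(* The notations of [monalg] clash with those of MathComp-Analysis. *)
From mathcomp Require Import -(notations) monalg.

Set Implicit Arguments.
Unset Strict Implicit.
Unset Printing Implicit Defensive.

Import Order.TTheory GRing.Theory Num.Theory.
Import numFieldNormedType.Exports.

Local Open Scope classical_set_scope.
Local Open Scope ring_scope.
Local Open Scope quotient_scope.

Section PosReal.
Context (R : realType).

Record posreal : predArgType := PosReal { posr :> R; _ : 0 < posr }.

HB.instance Definition _ := [isSub for posr].
HB.instance Definition _ := [Choice of posreal by <:].

Implicit Types x y z : posreal.

Lemma posr_gt0 x : 0 < x :> R. Proof. by case: x. Qed.

Definition posr_one : posreal := PosReal ltr01.
Definition posr_mul x y : posreal := PosReal (mulr_gt0 (posr_gt0 x) (posr_gt0 y)).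
Lemma posr_invP x : 0 < (val x)^-1. Proof. by rewrite invr_gt0 posr_gt0. Qed.
Definition posr_inv x : posreal := PosReal (posr_invP x).

Lemma posr_mulA : associative posr_mul.
Proof. by move=> x y z; apply: val_inj; rewrite /= mulrA. Qed.
Lemma posr_mulC : commutative posr_mul.
Proof. by move=> x y; apply: val_inj; rewrite /= mulrC. Qed.
Lemma posr_mul1 : left_id posr_one posr_mul.
Proof. by move=> x; apply: val_inj; rewrite /= mul1r. Qed.
Lemma posr_mulx1 : right_id posr_one posr_mul.
Proof. by move=> x; apply: val_inj; rewrite /= mulr1. Qed.
Lemma posr_mulV : left_inverse posr_one posr_inv posr_mul.
Proof. by move=> x; apply: val_inj; rewrite /= mulVf // gt_eqF // posr_gt0. Qed.
Lemma posr_mulxV : right_inverse posr_one posr_inv posr_mul.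
Proof. by move=> x; rewrite posr_mulC posr_mulV. Qed.

HB.instance Definition _ := isGroup.Build posreal
  posr_mulA posr_mul1 posr_mulx1 posr_mulV posr_mulxV.

End PosReal.

Section GroupRing.
Context (R : realType).
Local Notation G := (posreal R).

(* The rational vector space with basis [G].  The ring structure of [monalg]
   needs a monoid without invertible elements, so it is built anew here. *)
Definition WQ : Type := malg (posreal R) rat.
HB.instance Definition _ := GRing.Lmodule.on WQ.

Implicit Types (g : WQ) (k : G).

Definition wq_mul g1 g2 : WQ :=
  \sum_(x <- msupp g1) \sum_(y <- msupp g2)
     mkmalgU (x * y)%g (mcoeff x g1 * mcoeff y g2).

(* [brk x] is the element [x] of the group ring (square brackets of the paper). *)
Definition brk (x : G) : WQ := mkmalgU x 1.

Lemma wq_mulw (d1 d2 : {fset G}) g1 g2 :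
  (msupp g1 `<=` d1)%fset -> (msupp g2 `<=` d2)%fset ->
  wq_mul g1 g2 = \sum_(x <- d1) \sum_(y <- d2)
     mkmalgU (x * y)%g (mcoeff x g1 * mcoeff y g2).
Proof.
move=> le_d1 le_d2; rewrite /wq_mul (big_fset_incl _ le_d1) /=.
  apply/eq_bigr=> k1 _; apply/big_fset_incl => // k _ /mcoeff_outdom ->.
  by rewrite mulr0 monalgU0.
move=> k _ /mcoeff_outdom g1k.
by rewrite big1 => // k' _; rewrite g1k mul0r monalgU0.
Qed.

Lemma wq_mulC : commutative wq_mul.
Proof.
move=> g1 g2; rewrite /wq_mul [LHS]exchange_big /=; apply: eq_bigr => x _.
by apply: eq_bigr => y _; rewrite mulrC; congr mkmalgU; exact: posr_mulC.
Qed.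

Lemma wq_mul0 : left_zero 0 wq_mul.
Proof. by move=> g; rewrite /wq_mul msupp0 big_seq_fset0. Qed.

Lemma wq_mulDl : left_distributive wq_mul +%R.
Proof.
move=> g1 g2 g; have sub := fsubset_refl (msupp g).
rewrite (wq_mulw (msuppD_le g1 g2) sub).
rewrite (wq_mulw (fsubsetUl (msupp g1) (msupp g2)) sub).
rewrite (wq_mulw (fsubsetUr (msupp g1) (msupp g2)) sub).
rewrite -big_split /=; apply/eq_bigr=> k1 _.
rewrite -big_split /=; apply/eq_bigr=> k2 _.
by rewrite mcoeffD mulrDl monalgUD.
Qed.

Lemma wq_mulUU c1 c2 (k1 k2 : G) :
  wq_mul (mkmalgU k1 c1) (mkmalgU k2 c2) = mkmalgU (k1 * k2)%g (c1 * c2).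
Proof. by rewrite (wq_mulw msuppU_le msuppU_le) !big_seq_fset1 !mcoeffUU. Qed.

Lemma wq_mulDr : right_distributive wq_mul +%R.
Proof. by move=> g g1 g2; rewrite wq_mulC wq_mulDl ![wq_mul _ g]wq_mulC. Qed.

Lemma wq_mulx0 : right_zero 0 wq_mul.
Proof. by move=> g; rewrite wq_mulC wq_mul0. Qed.

Lemma wq_mul_suml (I : Type) (s : seq I) (F : I -> WQ) g :
  wq_mul (\sum_(i <- s) F i) g = \sum_(i <- s) wq_mul (F i) g.
Proof. exact: (big_morph (wq_mul^~ g) (fun _ _ => wq_mulDl _ _ _) (wq_mul0 _)). Qed.

Lemma wq_mul_sumr (I : Type) (s : seq I) (F : I -> WQ) g :
  wq_mul g (\sum_(i <- s) F i) = \sum_(i <- s) wq_mul g (F i).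
Proof. exact: (big_morph (wq_mul g) (fun _ _ => wq_mulDr _ _ _) (wq_mulx0 _)). Qed.

Lemma wq_mulA : associative wq_mul.
Proof.
move=> g1 g2 g3; pose U (g : WQ) x : WQ := mkmalgU x (mcoeff x g).
have E g : g = \sum_(x <- msupp g) U g x by exact: monalgE.
rewrite (E g1) !(wq_mul_suml _ (U g1)) (wq_mul_suml _ (fun x => wq_mul (U g1 x) g2)).
apply: eq_bigr => x _; rewrite (E g2) (wq_mul_suml _ (U g2)) !(wq_mul_sumr _ _ (U g1 x)).
rewrite (wq_mul_suml _ (fun y => wq_mul (U g1 x) (U g2 y))).
apply: eq_bigr => y _; rewrite (E g3) (wq_mul_sumr _ (U g3)) !wq_mul_sumr.
by apply: eq_bigr => z _; rewrite !wq_mulUU mulrA mulgA.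
Qed.

Lemma wq_mul1 : left_id (brk 1%g) wq_mul.
Proof.
move=> g; rewrite {1}(monalgE g) wq_mul_sumr [RHS](monalgE g).
by apply: eq_bigr => x _; rewrite wq_mulUU mul1g mul1r.
Qed.

Lemma wq_oner_neq0 : brk 1%g != 0 :> WQ.
Proof. by rewrite monalgU_eq0 oner_eq0. Qed.

HB.instance Definition _ := GRing.Zmodule_isComNzRing.Build WQ
  wq_mulA wq_mulC wq_mul1 wq_mulDl wq_oner_neq0.

Definition theta (X : WQ) : R := \sum_(x <- msupp X) ratr (mcoeff x X) * val x.

Lemma theta_mmap X : theta X = mmap ratr val X. Proof. by rewrite mmapE. Qed.

Lemma theta_zmod_morphism : zmod_morphism theta.
Proof. by move=> X Y; rewrite !theta_mmap raddfB. Qed.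

HB.instance Definition _ := GRing.isZmodMorphism.Build WQ R theta theta_zmod_morphism.

Lemma thetaU c (k : G) : theta (mkmalgU k c) = ratr c * val k.
Proof. by rewrite theta_mmap mmapU. Qed.

Lemma theta_brk (k : G) : theta (brk k) = val k.
Proof. by rewrite thetaU rmorph1 mul1r. Qed.

Lemma theta_monoid_morphism : monoid_morphism theta.
Proof.
split=> [|X Y]; first by rewrite theta_brk.
rewrite [X * Y]/(wq_mul X Y) /wq_mul raddf_sum mulr_suml; apply: eq_bigr => x _.
rewrite raddf_sum mulr_sumr; apply: eq_bigr => y _.
by rewrite /= thetaU rmorphM /= mulrACA.
Qed.

HB.instance Definition _ := GRing.isMonoidMorphism.Build WQ R theta
  theta_monoid_morphism.

Definition ker_theta : {pred WQ} := [pred X | theta X == 0].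

(* The extension of [brk] to all reals, with [0] = 0 and [-x] = -[x]. *)
Definition brkR (r : R) : WQ :=
  if insub r : option G is Some x then brk x
  else if insub (- r) : option G is Some y then - brk y else 0.

Lemma theta_brkR r : theta (brkR r) = r.
Proof.
rewrite /brkR; case: insubP => [x _ <-|]; first exact: theta_brk.
rewrite -leNgt => r_le0; case: insubP => [y _ yE|].
  by rewrite raddfN /= theta_brk yE opprK.
by rewrite oppr_gt0 -leNgt raddf0 => r_ge0; apply/eqP; rewrite eq_le r_ge0.
Qed.

End GroupRing.

Section IdealPower.
Context (A : comNzRingType) (I : {pred A}).

(* The ideal generated by the products of [n] elements of [I]. *)
Definition in_ideal_pow (n : nat) (X : A) : Prop :=
  exists (m : nat) (c : 'I_m -> A) (k : 'I_m -> 'I_n -> A),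
    (forall i j, k i j \in I) /\ X = \sum_(i < m) c i * \prod_(j < n) k i j.

Definition ideal_pow (n : nat) : {pred A} := [pred X | `[< in_ideal_pow n X >]].

Lemma ideal_powP n X : reflect (in_ideal_pow n X) (X \in ideal_pow n).
Proof. exact: asboolP. Qed.

Lemma ideal_pow0 n : 0 \in ideal_pow n.
Proof.
apply/ideal_powP; exists 0%N, (fun=> 0), (fun _ _ => 0).
by split=> [[]//|]; rewrite big_ord0.
Qed.

Lemma ideal_powMD n a : {in ideal_pow n &, forall u v, a * u + v \in ideal_pow n}.
Proof.
move=> u v /ideal_powP[m1 [c1 [k1 [k1I ->]]]] /ideal_powP[m2 [c2 [k2 [k2I ->]]]].
pose c i := match fintype.split i with inl i => a * c1 i | inr i => c2 i end.
pose k (i : 'I_(m1 + m2)) j :=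
  match fintype.split i with inl i => k1 i j | inr i => k2 i j end.
apply/ideal_powP; exists (m1 + m2)%N, c, k; split.
  by move=> i j; rewrite /k; case: fintype.split.
rewrite big_split_ord /= mulr_sumr; congr (_ + _); apply: eq_bigr => i _.
  rewrite mulrA /c /k (unsplitK (inl i : 'I_m1 + 'I_m2)).
  by congr (_ * _); apply: eq_bigr => j _.
rewrite /c /k (unsplitK (inr i : 'I_m1 + 'I_m2)).
by congr (_ * _); apply: eq_bigr => j _.
Qed.

Lemma ideal_pow_le n : {subset ideal_pow n.+1 <= ideal_pow n}.
Proof.
move=> X /ideal_powP[m [c [k [kI ->]]]]; apply/ideal_powP.
exists m, (fun i => c i * k i ord0), (fun i j => k i (lift ord0 j)); split=> //.
by apply: eq_bigr => i _; rewrite big_ord_recl mulrA.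
Qed.

End IdealPower.

Section InverseLimit.
Context (Q : nat -> comNzRingType) (p : forall n, {rmorphism Q n.+1 -> Q n}).

Record invlim : Type := InvLim {
  lim_coord :> forall n, Q n;
  lim_coordP : forall n, p n (lim_coord n.+1) = lim_coord n }.

Implicit Types x y z : invlim.

Lemma invlimP x y : (forall n, lim_coord x n = lim_coord y n) -> x = y.
Proof.
case: x y => [x xP] [y yP] /= xy.
have {}xy : x = y by apply: functional_extensionality_dep.
by subst y; congr InvLim; apply: Prop_irrelevance.
Qed.

HB.instance Definition _ := gen_eqMixin invlim.
HB.instance Definition _ := gen_choiceMixin invlim.

Program Definition invlim_zero := @InvLim (fun=> 0) _.
Next Obligation. by move=> n; rewrite rmorph0. Qed.
Program Definition invlim_one := @InvLim (fun=> 1) _.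
Next Obligation. by move=> n; rewrite rmorph1. Qed.
Program Definition invlim_opp x := @InvLim (fun n => - lim_coord x n) _.
Next Obligation. by move=> x n; rewrite rmorphN lim_coordP. Qed.
Program Definition invlim_add x y := @InvLim (fun n => lim_coord x n + lim_coord y n) _.
Next Obligation. by move=> x y n; rewrite rmorphD !lim_coordP. Qed.
Program Definition invlim_mul x y := @InvLim (fun n => lim_coord x n * lim_coord y n) _.
Next Obligation. by move=> x y n; rewrite rmorphM !lim_coordP. Qed.

Lemma invlim_addA : associative invlim_add.
Proof. by move=> x y z; apply: invlimP => n; exact: addrA. Qed.
Lemma invlim_addC : commutative invlim_add.
Proof. by move=> x y; apply: invlimP => n; exact: addrC. Qed.
Lemma invlim_add0 : left_id invlim_zero invlim_add.
Proof. by move=> x; apply: invlimP => n; exact: add0r. Qed.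
Lemma invlim_addN : left_inverse invlim_zero invlim_opp invlim_add.
Proof. by move=> x; apply: invlimP => n; exact: addNr. Qed.

HB.instance Definition _ := GRing.isZmodule.Build invlim
  invlim_addA invlim_addC invlim_add0 invlim_addN.

Lemma invlim_mulA : associative invlim_mul.
Proof. by move=> x y z; apply: invlimP => n; exact: mulrA. Qed.
Lemma invlim_mulC : commutative invlim_mul.
Proof. by move=> x y; apply: invlimP => n; exact: mulrC. Qed.
Lemma invlim_mul1 : left_id invlim_one invlim_mul.
Proof. by move=> x; apply: invlimP => n; exact: mul1r. Qed.
Lemma invlim_mulDl : left_distributive invlim_mul +%R.
Proof. by move=> x y z; apply: invlimP => n; exact: mulrDl. Qed.
Lemma invlim_oner_neq0 : invlim_one != 0.
Proof.
apply/eqP => /(congr1 (fun x => lim_coord x 0%N)) /eqP.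
by rewrite /= oner_eq0.
Qed.

HB.instance Definition _ := GRing.Zmodule_isComNzRing.Build invlim
  invlim_mulA invlim_mulC invlim_mul1 invlim_mulDl invlim_oner_neq0.

End InverseLimit.

Section Rinf.
Context (R : realType).

Definition ker_pow (n : nat) : {pred WQ R} := ideal_pow (@ker_theta R) n.

Lemma ker_powS_theta n X : X \in ker_pow n.+1 -> theta X = 0.
Proof.
move=> /ideal_powP[m [c [k [kI ->]]]].
rewrite raddf_sum big1 // => i _; rewrite /= rmorphM /= big_ord_recl rmorphM /=.
by have /eqP -> := kI i ord0; rewrite mul0r mulr0.
Qed.

Lemma ker_pow1 : ker_pow 1 =i @ker_theta R.
Proof.
move=> X; apply/idP/idP => [/ker_powS_theta/eqP //|X0]; apply/ideal_powP.
by exists 1%N, (fun=> 1), (fun _ _ => X); rewrite !big_ord1 mul1r.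
Qed.

Lemma ker_powS_idealr n : idealr_closed (ker_pow n.+1).
Proof.
split; [exact: ideal_pow0 | | exact: ideal_powMD].
apply/negP => /ker_powS_theta /eqP.
by rewrite rmorph1 oner_eq0.
Qed.

HB.instance Definition _ n := isIdealr.Build (WQ R) (ker_pow n.+1)
  (@ker_powS_idealr n).

(* The trivial quotient by Ker(theta)^0 is omitted: the exponents of the system
   start at 1. *)
Local Notation wq_quot n := {ideal_quot (ker_pow n.+1)}.

Definition wq_proj (n : nat) (x : wq_quot n.+1) : wq_quot n :=
  \pi_{ideal_quot (ker_pow n.+1)} (repr x).

Lemma wq_projE n (X : WQ R) : wq_proj (\pi_{ideal_quot (ker_pow n.+2)} X) = \pi_{ideal_quot (ker_pow n.+1)} X.
Proof.
apply/eqP; rewrite -Quotient.idealrBE; apply: ideal_pow_le.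
rewrite -[ideal_pow _ _]/(ker_pow n.+2).
by rewrite Quotient.idealrBE reprK.
Qed.

Lemma wq_proj_zmod_morphism n : zmod_morphism (@wq_proj n).
Proof.
move=> x y; rewrite -[x]reprK -[y]reprK -rmorphB /= !wq_projE.
by rewrite rmorphB.
Qed.

HB.instance Definition _ n := GRing.isZmodMorphism.Build (wq_quot n.+1) (wq_quot n)
  (@wq_proj n) (@wq_proj_zmod_morphism n).

Lemma wq_proj_monoid_morphism n : monoid_morphism (@wq_proj n).
Proof.
split=> [|x y]; first by rewrite -(rmorph1 (\pi_{ideal_quot (ker_pow n.+2)})) wq_projE rmorph1.
by rewrite -[x]reprK -[y]reprK -rmorphM /= !wq_projE rmorphM.
Qed.

HB.instance Definition _ n := GRing.isMonoidMorphism.Build (wq_quot n.+1) (wq_quot n)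
  (@wq_proj n) (@wq_proj_monoid_morphism n).

Definition wq_class (n : nat) (X : WQ R) : wq_quot n :=
  \pi_{ideal_quot (ker_pow n.+1)} X.

Definition Rinf : comNzRingType :=
  invlim (Q := fun n => wq_quot n) (fun n => @wq_proj n).

End Rinf.

Section PowerSeries.
Context (A : comNzRingType).

Record fps : Type := Fps { fcoef : nat -> A }.

Implicit Types f g h : fps.

Lemma fpsP f g : (forall n, fcoef f n = fcoef g n) -> f = g.
Proof. by case: f g => [f] [g] /= fg; congr Fps; apply/funext. Qed.

HB.instance Definition _ := gen_eqMixin fps.
HB.instance Definition _ := gen_choiceMixin fps.

Definition fps_zero := Fps (fun=> 0).
Definition fps_one := Fps (fun n => (n == 0%N)%:R).
Definition fps_opp f := Fps (fun n => - fcoef f n).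
Definition fps_add f g := Fps (fun n => fcoef f n + fcoef g n).
Definition fps_mul f g :=
  Fps (fun n => \sum_(i < n.+1) fcoef f i * fcoef g (n - i)%N).

Lemma fps_addA : associative fps_add.
Proof. by move=> f g h; apply: fpsP => n; exact: addrA. Qed.
Lemma fps_addC : commutative fps_add.
Proof. by move=> f g; apply: fpsP => n; exact: addrC. Qed.
Lemma fps_add0 : left_id fps_zero fps_add.
Proof. by move=> f; apply: fpsP => n; exact: add0r. Qed.
Lemma fps_addN : left_inverse fps_zero fps_opp fps_add.
Proof. by move=> f; apply: fpsP => n; exact: addNr. Qed.

HB.instance Definition _ := GRing.isZmodule.Build fps
  fps_addA fps_addC fps_add0 fps_addN.

Definition fps_trunc (N : nat) f : {poly A} := \poly_(i < N.+1) fcoef f i.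

Lemma fps_truncE N f i : (i <= N)%N -> (fps_trunc N f)`_i = fcoef f i.
Proof. by move=> iN; rewrite coef_poly ltnS iN. Qed.

Lemma fps_mul_trunc N f g i : (i <= N)%N ->
  fcoef (fps_mul f g) i = (fps_trunc N f * fps_trunc N g)`_i.
Proof.
move=> iN; rewrite coefM /=; apply: eq_bigr => j _.
by rewrite !fps_truncE // ?(leq_trans (leq_subr _ _)) // (leq_trans _ iN) // -ltnS.
Qed.

Lemma fps_mulC : commutative fps_mul.
Proof.
by move=> f g; apply: fpsP => n; rewrite !(fps_mul_trunc _ _ (leqnn n)) mulrC.
Qed.

Lemma fps_mulA : associative fps_mul.
Proof.
move=> f g h; apply: fpsP => n.
transitivity ((fps_trunc n f * (fps_trunc n g * fps_trunc n h))`_n).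
  rewrite coefM; apply: eq_bigr => i _.
  by rewrite fps_truncE -1?ltnS // (fps_mul_trunc _ _ (leq_subr _ _)).
rewrite mulrA coefM; apply: eq_bigr => i _.
by rewrite (fps_truncE _ (leq_subr _ _)) -fps_mul_trunc // -ltnS.
Qed.

Lemma fps_mul1 : left_id fps_one fps_mul.
Proof.
move=> f; apply: fpsP => n; rewrite /= big_ord_recl subn0 mul1r big1 ?addr0 //.
by move=> i _; rewrite mul0r.
Qed.

Lemma fps_mulDl : left_distributive fps_mul +%R.
Proof.
move=> f g h; apply: fpsP => n; rewrite /= -big_split /=.
by apply: eq_bigr => i _; rewrite mulrDl.
Qed.

Lemma fps_oner_neq0 : fps_one != 0.
Proof.
apply/eqP => /(congr1 (fun f => fcoef f 0%N)) /eqP.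
by rewrite /= oner_eq0.
Qed.

HB.instance Definition _ := GRing.Zmodule_isComNzRing.Build fps
  fps_mulA fps_mulC fps_mul1 fps_mulDl fps_oner_neq0.

End PowerSeries.

Section Smooth.
Context (R : realType).
Implicit Types f g : R -> R.

Definition is_smooth f : Prop := forall (n : nat) (x : R), derivable (derive1n n f) x 1.

Definition smooth_pred : {pred (R -> R)} := [pred f | `[< is_smooth f >]].

Fixpoint diffn (n : nat) f : Prop :=
  if n is m.+1 then (forall x, derivable f x 1) /\ diffn m (derive1 f) else True.

Lemma smooth_diffn f : is_smooth f <-> forall n, diffn n f.
Proof.
have shift h n : derive1n n (derive1 h) = derive1n n.+1 h by rewrite /derive1n iterSr.
split=> [fs n|fd n].
  elim: n f fs => //= n IH f fs; split; first exact: (fs 0%N).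
  by apply: IH => m x; rewrite shift; exact: fs.
elim: n f fd => [|n IH] f fd; first by move=> x; have [] := fd 1%N.
by rewrite -shift; apply: IH => m; have [] := fd m.+1.
Qed.

Lemma derive1_sub f g : (forall x, derivable f x 1) -> (forall x, derivable g x 1) ->
  derive1 (f - g) = derive1 f - derive1 g.
Proof.
move=> df dg; apply/funext => x.
by rewrite derive1E deriveB // -!derive1E.
Qed.

Lemma diffnB n f g : diffn n f -> diffn n g -> diffn n (f - g).
Proof.
elim: n f g => //= n IH f g [df nf] [dg ng]; split.
  by move=> x; apply: derivableB.
by rewrite derive1_sub //; apply: IH.
Qed.

Lemma diffn_le n f : diffn n.+1 f -> diffn n f.
Proof.
elim: n f => //= n IH f [df [ddf nf]]; split=> //.
by apply: IH; split.
Qed.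

Lemma diffn0 n : diffn n (0 : R -> R).
Proof.
elim: n => //= n IH; split; first by move=> x; apply: derivable_cst.
suff -> : derive1 (0 : R -> R) = 0 by [].
by apply/funext => x; rewrite derive1_cst.
Qed.

Lemma diffnD n f g : diffn n f -> diffn n g -> diffn n (f + g).
Proof.
move=> nf ng; rewrite -[g]opprK; apply: diffnB => //.
by rewrite -sub0r; apply: diffnB => //; exact: diffn0.
Qed.

Lemma diffnM n f g : diffn n f -> diffn n g -> diffn n (f * g).
Proof.
elim: n f g => // n IH f g nf ng; move: (nf) (ng) => [df nf'] [dg ng']; split.
  by move=> x; apply: derivableM.
suff -> : derive1 (f * g) = f * derive1 g + g * derive1 f.
  by apply: diffnD; apply: IH => //; exact: diffn_le.
by apply/funext => x; rewrite derive1E deriveM // -!derive1E.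
Qed.

Lemma diffn1 n : diffn n (1 : R -> R).
Proof.
case: n => //= n; split; first by move=> x; apply: derivable_cst.
suff -> : derive1 (1 : R -> R) = 0 by apply: diffn0.
by apply/funext => x; rewrite derive1_cst.
Qed.

Lemma smooth_subring : subring_closed smooth_pred.
Proof.
split=> [|f g|f g].
- by apply/asboolP/smooth_diffn => n; exact: diffn1.
- move=> /asboolP/smooth_diffn fs /asboolP/smooth_diffn gs.
  by apply/asboolP/smooth_diffn => n; exact: diffnB.
- move=> /asboolP/smooth_diffn fs /asboolP/smooth_diffn gs.
  by apply/asboolP/smooth_diffn => n; exact: diffnM.
Qed.

HB.instance Definition _ := GRing.isSubringClosed.Build (R -> R) smooth_pred
  smooth_subring.

Record Cinf : Type := MkCinf { cinf_fun :> R -> R; _ : cinf_fun \in smooth_pred }.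

HB.instance Definition _ := [isSub for cinf_fun].
HB.instance Definition _ := [Choice of Cinf by <:].
HB.instance Definition _ := [SubChoice_isSubComNzRing of Cinf by <:].

(* The Taylor expansion at [1]; the variable of the series is [z - 1]. *)
Definition taylor1 (f : Cinf) : fps R := Fps (fun n => derive1n n f 1 / n`!%:R).

End Smooth.

Section Cotangent.
Context (R : realType).

Lemma ker_theta_zmod : zmod_closed (@ker_theta R).
Proof.
split=> [|X Y]; first by rewrite inE raddf0.
by rewrite !inE raddfB /= => /eqP -> /eqP ->; rewrite subr0.
Qed.

HB.instance Definition _ := GRing.isZmodClosed.Build (WQ R) (@ker_theta R)
  ker_theta_zmod.

Record KerTheta : Type := MkKer { ker_val :> WQ R; _ : ker_val \in @ker_theta R }.

HB.instance Definition _ := [isSub for ker_val].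
HB.instance Definition _ := [Choice of KerTheta by <:].
HB.instance Definition _ := [SubChoice_isSubZmodule of KerTheta by <:].

Definition ker2 : {pred KerTheta} := [pred u | val u \in ker_pow 2].

Lemma ker2E u : (u \in ker2) = (val u \in ker_pow 2). Proof. by []. Qed.

Lemma ker2_zmod : zmod_closed ker2.
Proof.
split=> [|u v]; first by rewrite ker2E -[val 0]/(0 : WQ R) rpred0.
by rewrite !ker2E -[val (u - v)]/(val u - val v); exact: rpredB.
Qed.

HB.instance Definition _ := GRing.isZmodClosed.Build KerTheta ker2 ker2_zmod.

Definition cotangent : Type := Quotient.quot ker2.
HB.instance Definition _ := GRing.Zmodule.on cotangent.

Definition ker_class (u : KerTheta) : cotangent := \pi_(Quotient.quot ker2) u.

Lemma ker_scale_subproof (w : WQ R) (u : KerTheta) : w * val u \in @ker_theta R.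
Proof. by case: u => u /= /eqP u0; rewrite inE rmorphM /= u0 mulr0. Qed.

Definition ker_scale (w : WQ R) (u : KerTheta) : KerTheta :=
  MkKer (ker_scale_subproof w u).

(* A real [r] acts as any element of [WQ R] whose image under [theta] is [r];
   [brkR r] is one, and [cotangent_scaleE] shows that the choice is immaterial. *)
Definition cotangent_scale (r : R) (x : cotangent) : cotangent :=
  ker_class (ker_scale (brkR r) (repr x)).

Lemma ker_class_eq (u v : KerTheta) :
  (ker_class u = ker_class v) <-> (val u - val v \in ker_pow 2).
Proof.
have -> : (val u - val v \in ker_pow 2) = (u - v \in ker2).
  by rewrite ker2E -[val (u - v)]/(val u - val v).
by rewrite Quotient.idealrBE; split=> /eqP.
Qed.

Lemma ker_theta_mul2 (X Y : WQ R) : X \in @ker_theta R -> Y \in @ker_theta R ->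
  X * Y \in ker_pow 2.
Proof.
move=> X0 Y0; apply/ideal_powP.
exists 1%N, (fun=> 1), (fun _ j => if j == ord0 then X else Y); split.
  by move=> i j; case: ifP.
by rewrite big_ord1 !big_ord_recl big_ord0 mul1r mulr1.
Qed.

Lemma cotangent_scaleE (w : WQ R) (u : KerTheta) :
  cotangent_scale (theta w) (ker_class u) = ker_class (ker_scale w u).
Proof.
apply/ker_class_eq => /=; set v := repr _.
have -> : brkR (theta w) * val v - w * val u
    = w * (val v - val u) + (brkR (theta w) - w) * val v.
  by rewrite mulrBr mulrBl [RHS]addrC addrA subrK.
apply: rpredD; last first.
  apply: ker_theta_mul2; last by case: (v).
  by rewrite inE raddfB /= theta_brkR subrr.
apply: idealMr; apply/ker_class_eq; exact: reprK.
Qed.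

Lemma ker_classK (x : cotangent) : exists u, x = ker_class u.
Proof. by exists (repr x); rewrite /ker_class reprK. Qed.

Lemma ker_classD u v : ker_class (u + v) = ker_class u + ker_class v.
Proof. exact: (raddfD (\pi_(Quotient.quot ker2))). Qed.

Lemma cotangent_scaleA a b x :
  cotangent_scale a (cotangent_scale b x) = cotangent_scale (a * b) x.
Proof.
have [u ->] := ker_classK x; rewrite -(theta_brkR a) -(theta_brkR b) -rmorphM.
by rewrite !cotangent_scaleE; apply/ker_class_eq; rewrite /= mulrA subrr rpred0.
Qed.

Lemma cotangent_scale1 : left_id 1 cotangent_scale.
Proof.
move=> x; have [u ->] := ker_classK x; rewrite -(rmorph1 (@theta R)).
by rewrite cotangent_scaleE; apply/ker_class_eq; rewrite /= mul1r subrr rpred0.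
Qed.

Lemma cotangent_scaleDr : right_distributive cotangent_scale +%R.
Proof.
move=> a x y; have [u ->] := ker_classK x; have [v ->] := ker_classK y.
rewrite -(theta_brkR a) -ker_classD !cotangent_scaleE -ker_classD.
by apply/ker_class_eq; rewrite /= mulrDr subrr rpred0.
Qed.

Lemma cotangent_scaleDl x : {morph cotangent_scale^~ x : a b / a + b}.
Proof.
move=> a b; have [u ->] := ker_classK x.
rewrite -(theta_brkR a) -(theta_brkR b) -rmorphD !cotangent_scaleE -ker_classD.
by apply/ker_class_eq; rewrite /= mulrDl subrr rpred0.
Qed.

HB.instance Definition _ := GRing.Zmodule_isLmodule.Build R cotangent
  cotangent_scaleA cotangent_scale1 cotangent_scaleDr cotangent_scaleDl.

Lemma period_subproof (p : nat) : brkR p%:R - p%:R \in @ker_theta R.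
Proof. by rewrite inE raddfB /= theta_brkR rmorph_nat subrr. Qed.

Definition period (p : nat) : cotangent := ker_class (MkKer (period_subproof p)).

End Cotangent.

Definition finite_dimensional (K : fieldType) (V : lmodType K) : Prop :=
  exists (n : nat) (b : 'I_n -> V),
    forall v : V, exists c : 'I_n -> K, v = \sum_(i < n) c i *: b i.

Definition linearly_independent (K : fieldType) (V : lmodType K) (I : choiceType)
    (P : {pred I}) (v : I -> V) : Prop :=
  forall (s : seq I) (c : I -> K), uniq s -> {subset s <= P} ->
    \sum_(i <- s) c i *: v i = 0 -> {in s, forall i, c i = 0}.

(* Main.v *)
Require Import Defs.
From HB Require Import structures.
From mathcomp Require Import all_boot all_order all_algebra.
From mathcomp Require Import finmap.
From mathcomp Require Import all_classical all_reals all_analysis.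
From mathcomp Require Import -(notations) monalg.

(**
For a homomorphism [ell], each map [x |-> exp (ln x + (z - 1) * ell x)] is
multiplicative, so it extends to a ring homomorphism on the group ring; varying
[z] gives [T], and [z = 1] gives back [theta].  By the Leibniz rule the Taylor
expansion at [1] is itself a ring homomorphism on smooth functions, so
[tau X = taylor1 (T X)] is a ring homomorphism from the group ring to power
series whose constant term is [theta].

Everything else in (ii) and the easy part of (iii) only uses this last
property.  Since [tau] sends [Ker theta] to series without constant term, it
sends [Ker theta ^ n] to series of order at least [n] ([ker_pow_vanishes]).
Hence the coefficients of degree at most [n] depend only on the class modulo
[Ker theta ^ (n+1)], which yields the homomorphism on the inverse limit.  If
some [U] in [Ker theta] has [tau U] of order exactly one, then a given series
[f] is hit by successive approximation: the error in degree [n] is removed by a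
multiple of [U ^ n], and any leading coefficient is available because [theta] is
onto ([Rinf_lift_onto]).  The hypothesis of (ii) says that
[U = [x] + [1 - x] - 1] is such an element.  Likewise, the coefficient of degree
one factors through a real linear form on [Ker theta / Ker theta ^ 2], whose
value on [period p] is [p * ell p].

For (iii) it remains to find, for each prime [p], a homomorphism [ell] with
[ell p = 1] and [ell q = 0] at all other primes [q]
([prime_dual_morphism]): the linear forms that they define then separate the
periods.  Take [ell = phi \o ln] with [phi] a linear form on the rational vector
space of real numbers.  By unique factorization [ln p] is outside the subspace
spanned by the logarithms of the integers prime to [p], and by Zorn's lemma a
vector outside a subspace is separated from it by a linear form
([linear_form_separating]).  As there are infinitely many primes, the space is
infinite dimensional.
*)

Set Implicit Arguments.
Unset Strict Implicit.
Unset Printing Implicit Defensive.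

Import Order.TTheory GRing.Theory Num.Theory.
Import numFieldNormedType.Exports.

Local Open Scope classical_set_scope.
Local Open Scope ring_scope.

(** * Coefficients of a product of power series *)

Section PowerSeriesCoefficients.
Context (A : comNzRingType).
Implicit Types f g : fps A.

Lemma fcoefD f g n : fcoef (f + g) n = fcoef f n + fcoef g n.
Proof. by []. Qed.

Lemma fcoefB f g n : fcoef (f - g) n = fcoef f n - fcoef g n.
Proof. by []. Qed.

Lemma fcoefM f g n :
  fcoef (f * g) n = \sum_(i < n.+1) fcoef f i * fcoef g (n - i)%N.
Proof. by []. Qed.

Lemma fcoefM0 f g : fcoef (f * g) 0 = fcoef f 0 * fcoef g 0.
Proof. by rewrite fcoefM big_ord1. Qed.

Lemma fcoefM1 f g :
  fcoef (f * g) 1 = fcoef f 0 * fcoef g 1 + fcoef f 1 * fcoef g 0.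
Proof. by rewrite fcoefM !big_ord_recr big_ord0 /= add0r. Qed.

(** The Leibniz rule for the formal derivative, read off on coefficients; it is
inherited from polynomials because the coefficient of degree [n.+1] only sees
the truncations at that degree. *)
Lemma fcoefM_deriv f g n :
  fcoef (f * g) n.+1 *+ n.+1 =
    \sum_(i < n.+1) (fcoef f i.+1 *+ i.+1) * fcoef g (n - i)%N
    + \sum_(i < n.+1) fcoef f i * (fcoef g (n - i).+1 *+ (n - i).+1).
Proof.
rewrite [LHS](congr1 (fun a => a *+ n.+1) (fps_mul_trunc f g (leqnn n.+1))).
rewrite -coef_deriv derivM coefD !coefM.
congr (_ + _); apply: eq_bigr => i _; have in1 : (i <= n)%N by rewrite -ltnS.
  by rewrite coef_deriv !fps_truncE // (leq_trans (leq_subr _ _)).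
by rewrite coef_deriv !fps_truncE // ?ltnS ?leq_subr // ltnW.
Qed.

End PowerSeriesCoefficients.

(** * Taylor expansion as a ring homomorphism *)

Section TaylorMorphism.
Context (R : realType).
Implicit Types f g : Cinf R.

Lemma cinf_smooth f : is_smooth f.
Proof. by case: f => f /= /asboolP. Qed.

Lemma cinf_derivable f x : derivable f x 1.
Proof. exact: cinf_smooth f 0%N x. Qed.

Lemma derive1nSr n (h : R -> R) : derive1n n.+1 h = derive1n n (derive1 h).
Proof. by rewrite /derive1n iterSr. Qed.

Lemma derive1_smooth f : derive1 f \in @smooth_pred R.
Proof. by apply/asboolP => n x; rewrite -derive1nSr; exact: cinf_smooth. Qed.

Definition cinf_deriv f : Cinf R := MkCinf (derive1_smooth f).

Lemma cinf_derivB f g : cinf_deriv (f - g) = cinf_deriv f - cinf_deriv g.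
Proof. by apply/val_inj/derive1_sub => x; exact: cinf_derivable. Qed.

Lemma cinf_derivM f g :
  cinf_deriv (f * g) = cinf_deriv f * g + f * cinf_deriv g.
Proof.
apply/val_inj/funext => x /=; rewrite derive1E.
rewrite deriveM; [|exact: cinf_derivable..]; rewrite -!derive1E addrC.
by rewrite [X in X + _ = _]mulrC.
Qed.

Lemma fcoef_taylor1_0 f : fcoef (taylor1 f) 0 = f 1.
Proof. by rewrite /= fact0 divr1. Qed.

(** The Taylor coefficients of [f] and of its derivative are related as those of
a power series and its formal derivative. In characteristic zero this determines
the coefficients from the constant terms, so identities between Taylor series
can be proved by induction on the degree, for all functions at once. *)
Lemma fcoef_taylor1S f n :
  fcoef (taylor1 f) n.+1 *+ n.+1 = fcoef (taylor1 (cinf_deriv f)) n.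
Proof.
have -> : fcoef (taylor1 f) n.+1 = derive1n n (derive1 f) 1 / n.+1`!%:R.
  by rewrite -derive1nSr.
by rewrite -[LHS]mulr_natr factS natrM invfM mulrA mulrAC divfK //.
Qed.

Lemma fcoef_taylor1_1 f : fcoef (taylor1 f) 1 = derive1 f 1.
Proof. by rewrite -[LHS]mulr1n fcoef_taylor1S fcoef_taylor1_0. Qed.

Lemma taylor1_zmod_morphism : zmod_morphism (@taylor1 R).
Proof.
move=> f g; apply: fpsP => n; elim: n f g => [|n IH] f g.
  by rewrite fcoefB !fcoef_taylor1_0.
apply: (@pmulrnI R n.+1) => //.
by rewrite fcoefB mulrnBl !fcoef_taylor1S cinf_derivB IH.
Qed.

HB.instance Definition _ := GRing.isZmodMorphism.Build (Cinf R) (fps R)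
  (@taylor1 R) taylor1_zmod_morphism.

Lemma taylor1_monoid_morphism : monoid_morphism (@taylor1 R).
Proof.
split=> [|f g]; apply: fpsP => n.
  elim: n => [|n IH]; first by rewrite fcoef_taylor1_0.
  have d1 : cinf_deriv 1 = 0 :> Cinf R.
    by apply/val_inj/funext => x; rewrite /= derive1_cst.
  by apply: (@pmulrnI R n.+1) => //; rewrite fcoef_taylor1S d1 raddf0 mul0rn.
elim: n f g => [|n IH] f g; first by rewrite fcoefM0 !fcoef_taylor1_0.
apply: (@pmulrnI R n.+1) => //; rewrite fcoef_taylor1S cinf_derivM.
rewrite fcoefM_deriv raddfD fcoefD !IH !fcoefM.
by congr (_ + _); apply: eq_bigr => i _; rewrite fcoef_taylor1S.
Qed.

HB.instance Definition _ := GRing.isMonoidMorphism.Build (Cinf R) (fps R)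
  (@taylor1 R) taylor1_monoid_morphism.

End TaylorMorphism.

(** * Interpolating the evaluation of the group ring by exponentials *)

Section GroupRingExtension.
Context (R : realType).

(** The universal property of the group ring, for characters with real values. *)
Lemma mmap_monoid_morphism (g : posreal R -> R) :
    g 1%g = 1 -> {morph g : x y / (x * y)%g >-> x * y} ->
  monoid_morphism (fun X : WQ R => mmap ratr g X).
Proof.
move=> g1 gM; split=> [|X Y]; first by rewrite mmapU /= g1 rmorph1 mulr1.
rewrite [X * Y]/(wq_mul X Y) /wq_mul raddf_sum [X in _ = X * _]mmapE mulr_suml.
apply: eq_bigr => x _; rewrite raddf_sum [mmap _ _ Y]mmapE mulr_sumr.
by apply: eq_bigr => y _; rewrite /= mmapU /= rmorphM gM /= mulrACA.
Qed.

End GroupRingExtension.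

Section Interpolation.
Context (R : realType).

Definition exp_line (a b : R) : R -> R := fun z => expR (a + (z - 1) * b).

Lemma is_derive_exp_line (a b z : R) :
  is_derive z 1 (exp_line a b) (b * exp_line a b z).
Proof.
have -> : exp_line a b = expR \o (fun z => a + (z - 1) * b) by [].
have h : is_derive z 1 (fun z : R => a + (z - 1) * b) b.
  by apply: is_derive_eq; rewrite scaler0 !add0r mul1r subr0 [_ *: _]mulr1.
rewrite [b * _]mulrC; exact: (@is_derive1_comp R expR _ z).
Qed.

Lemma cst_smooth (c : R) : cst c \in @smooth_pred R.
Proof.
apply/asboolP/smooth_diffn=> -[//|n /=]; split=> [z|].
  exact: derivable_cst.
rewrite (_ : derive1 _ = 0); first exact: diffn0.
by apply/funext => z; rewrite derive1_cst.
Qed.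

Lemma exp_line_smooth a b : exp_line a b \in @smooth_pred R.
Proof.
have d z := is_derive_exp_line a b z.
apply/asboolP/smooth_diffn; elim=> //= n IH; split=> [z|].
  by have [] := d z.
suff -> : derive1 (exp_line a b) = cst b * exp_line a b.
  by have /asboolP/smooth_diffn cb := cst_smooth b; exact: diffnM.
by apply/funext => z; rewrite derive1E; have [_ ->] := d z.
Qed.

Context (ell : posreal R -> R).
Implicit Types (X : WQ R) (z : R).

Definition interp_fun X z : R :=
  mmap ratr (fun x : posreal R => exp_line (ln (val x)) (ell x) z) X.

Lemma interp_fun_smooth X : interp_fun X \in @smooth_pred R.
Proof.
have -> : interp_fun X = \sum_(x <- msupp X)
    cst (ratr (mcoeff x X)) * exp_line (ln (val x)) (ell x).
  by apply/funext => z; rewrite fct_sumE /interp_fun mmapE.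
apply: rpred_sum => x _.
by apply: rpredM; [exact: cst_smooth|exact: exp_line_smooth].
Qed.

Definition interp X : Cinf R := MkCinf (interp_fun_smooth X).

Lemma interpE X z : interp X z =
  \sum_(x <- msupp X) ratr (mcoeff x X) * expR (ln (val x) + (z - 1) * ell x).
Proof. exact: mmapE. Qed.

Lemma interp1 X : interp X 1 = theta X.
Proof.
rewrite interpE; apply: eq_bigr => x _.
by rewrite subrr mul0r addr0 lnK // posrE posr_gt0.
Qed.

Lemma interp_zmod_morphism : zmod_morphism interp.
Proof. by move=> X Y; apply/val_inj/funext => z; exact: raddfB. Qed.

HB.instance Definition _ := GRing.isZmodMorphism.Build (WQ R) (Cinf R) interp
  interp_zmod_morphism.

Lemma fcoef1_taylor1_interp (x : posreal R) :
  fcoef (taylor1 (interp (brk x))) 1 = val x * ell x.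
Proof.
rewrite fcoef_taylor1_1 /= derive1E.
have -> : interp_fun (brk x) = exp_line (ln (val x)) (ell x).
  by apply/funext => z; rewrite /interp_fun mmapU /= rmorph1 mul1r.
have [_ ->] := is_derive_exp_line (ln (val x)) (ell x) 1.
by rewrite /exp_line subrr mul0r addr0 lnK ?posrE ?posr_gt0 // mulrC.
Qed.

Context (ellM : {morph ell : x y / (x * y)%g >-> x + y}).

Lemma ell1 : ell 1%g = 0.
Proof. by apply: (addrI (ell 1%g)); rewrite -ellM mulg1 addr0. Qed.

Lemma interp_monoid_morphism : monoid_morphism interp.
Proof.
have M z : monoid_morphism (interp_fun^~ z).
  apply: mmap_monoid_morphism => [|x y].
    by rewrite /exp_line ell1 ln1 mulr0 addr0 expR0.
  rewrite /exp_line -expRD ellM lnM ?posrE ?posr_gt0 // mulrDr.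
  by rewrite addrACA.
by split=> [|X Y]; apply/val_inj/funext => z;
  [exact: (M z).1|exact: (M z).2].
Qed.

Definition interp_morph : {rmorphism WQ R -> Cinf R} :=
  HB.pack interp (GRing.isMonoidMorphism.Build (WQ R) (Cinf R) interp
    interp_monoid_morphism).

End Interpolation.

(** * Order of vanishing of power series *)

Section VanishingOrder.
Context (A : comNzRingType).
Implicit Types f g : fps A.

Definition vanishes n f : Prop := forall k, (k < n)%N -> fcoef f k = 0.

Lemma vanishesM m n f g :
  vanishes m f -> vanishes n g -> vanishes (m + n) (f * g).
Proof.
move=> fm gn k kmn; rewrite fcoefM big1 // => i _.
have [im|mi] := ltnP i m; first by rewrite fm // mul0r.
have ik : (i <= k)%N by rewrite -ltnS.
by rewrite gn ?mulr0 // ltn_subLR // (leq_trans kmn) // leq_add2r.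
Qed.

Lemma fcoefM_lead m n f g : vanishes m f -> vanishes n g ->
  fcoef (f * g) (m + n) = fcoef f m * fcoef g n.
Proof.
move=> fm gn; have mmn : (m < (m + n).+1)%N by rewrite ltnS leq_addr.
rewrite fcoefM (bigD1 (Ordinal mmn)) //= addKn big1 ?addr0 // => i im.
have [lt_im|le_mi] := ltnP i m; first by rewrite fm // mul0r.
have lt_mi : (m < i)%N by rewrite ltn_neqAle le_mi andbT eq_sym.
have in_mn : (i <= m + n)%N by rewrite -ltnS.
by rewrite gn ?mulr0 // ltn_subLR // ltn_add2r.
Qed.

Lemma vanishes_prod n (F : 'I_n -> fps A) :
  (forall j, vanishes 1 (F j)) -> vanishes n (\prod_(j < n) F j).
Proof.
elim: n F => [|n IH] F F1; first by [].
rewrite big_ord_recl; apply: (@vanishesM 1 n) => //.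
by apply: IH => j.
Qed.

Lemma vanishesX n f : vanishes 1 f -> vanishes n (f ^+ n).
Proof.
move=> f1; have -> : f ^+ n = \prod_(j < n) f by rewrite prodr_const card_ord.
exact: vanishes_prod.
Qed.

Lemma fcoefX_lead n f : vanishes 1 f -> fcoef (f ^+ n) n = fcoef f 1 ^+ n.
Proof.
move=> f1; elim: n => // n IH; rewrite !exprS -IH.
by apply: (@fcoefM_lead 1 n) => //; exact: vanishesX.
Qed.

Lemma fcoef_sum (I : Type) (s : seq I) (F : I -> fps A) k :
  fcoef (\sum_(i <- s) F i) k = \sum_(i <- s) fcoef (F i) k.
Proof. exact: (big_morph (fun f => fcoef f k) (fun _ _ => erefl) erefl). Qed.

End VanishingOrder.

(** * Homomorphisms to power series with constant term theta *)

Section LiftingTheta.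
Context (R : realType) (tau : {rmorphism WQ R -> fps R}).
Context (tau0 : forall X, fcoef (tau X) 0 = theta X).

Lemma ker_pow_vanishes n X : X \in ker_pow n -> vanishes n (tau X).
Proof.
move=> /ideal_powP[m [c [k [kI ->]]]] i lt_in.
rewrite rmorph_sum fcoef_sum big1 // => j _; rewrite rmorphM rmorph_prod.
rewrite -[n]add0n in lt_in; apply: (vanishesM _ _ lt_in) => //.
apply: vanishes_prod => l; case=> // _; rewrite tau0.
by apply/eqP; exact: kI.
Qed.

Lemma wq_class_eq n (X Y : WQ R) :
  (wq_class n X = wq_class n Y) <-> (X - Y \in ker_pow n.+1).
Proof. by rewrite Quotient.idealrBE; split=> /eqP. Qed.

(** This is the continuity of [tau] from the [Ker theta]-adic topology to the
topology of power series, without loss of precision. *)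
Lemma fcoef_class n k X Y : wq_class n X = wq_class n Y -> (k <= n)%N ->
  fcoef (tau X) k = fcoef (tau Y) k.
Proof.
move=> /wq_class_eq/ker_pow_vanishes v kn; apply/eqP; rewrite -subr_eq0.
by rewrite -fcoefB -rmorphB; apply/eqP/v.
Qed.

Lemma lim_coord_class (xi : Rinf R) n X : lim_coord xi n = wq_class n X ->
  forall k, (k <= n)%N -> lim_coord xi k = wq_class k X.
Proof.
elim: n X => [|n IH] X xiX k; first by rewrite leqn0 => /eqP ->.
rewrite leq_eqVlt => /predU1P[-> //|]; apply: IH.
by rewrite -lim_coordP xiX; exact: wq_projE.
Qed.

(** The coefficient of degree [k] is read at level [k] of the inverse system, the
first one at which it is well defined. *)
Definition Rinf_lift (xi : Rinf R) : fps R :=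
  Fps (fun k => fcoef (tau (repr (lim_coord xi k))) k).

Lemma fcoef_Rinf_lift (xi : Rinf R) n X : lim_coord xi n = wq_class n X ->
  forall k, (k <= n)%N -> fcoef (Rinf_lift xi) k = fcoef (tau X) k.
Proof.
move=> xiX k kn; apply: (@fcoef_class k) => //.
by rewrite -(lim_coord_class xiX kn); exact: reprK.
Qed.

Lemma lim_coord_repr (xi : Rinf R) n :
  lim_coord xi n = wq_class n (repr (lim_coord xi n)).
Proof. by rewrite /wq_class reprK. Qed.

Lemma Rinf_lift_zmod_morphism : zmod_morphism Rinf_lift.
Proof.
move=> x y; apply: fpsP => n; rewrite fcoefB.
set X := repr (lim_coord x n); set Y := repr (lim_coord y n).
rewrite (@fcoef_Rinf_lift _ n (X - Y)) //; first by rewrite rmorphB.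
by rewrite /wq_class rmorphB /= !reprK.
Qed.

Lemma Rinf_lift_monoid_morphism : monoid_morphism Rinf_lift.
Proof.
split=> [|x y]; apply: fpsP => n.
  by rewrite (@fcoef_Rinf_lift _ n 1) ?rmorph1 // /wq_class rmorph1.
set X := repr (lim_coord x n); set Y := repr (lim_coord y n).
rewrite (@fcoef_Rinf_lift _ n (X * Y)) //; last first.
  by rewrite /wq_class rmorphM /= !reprK.
rewrite rmorphM !fcoefM; apply: eq_bigr => i _.
by rewrite !(fcoef_Rinf_lift (lim_coord_repr _ n)) ?leq_subr // -ltnS.
Qed.

Definition Rinf_lift_morph : {rmorphism Rinf R -> fps R} :=
  HB.pack Rinf_lift
    (GRing.isZmodMorphism.Build (Rinf R) (fps R) Rinf_lift Rinf_lift_zmod_morphism)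
    (GRing.isMonoidMorphism.Build (Rinf R) (fps R) Rinf_lift
      Rinf_lift_monoid_morphism).

Section Surjectivity.
Context (U : WQ R) (U0 : theta U = 0) (U1 : fcoef (tau U) 1 != 0) (f : fps R).

(** Partial lifts of [f]: since [U ^+ n] has order exactly [n] under [tau], adding
a multiple of it corrects the coefficient of degree [n] and none below. *)
Fixpoint approx n : WQ R :=
  if n is m.+1 then
    approx m + brkR ((fcoef f n - fcoef (tau (approx m)) n) / fcoef (tau U) 1 ^+ n)
      * U ^+ n
  else brkR (fcoef f 0).

Lemma tauU_vanishes : vanishes 1 (tau U).
Proof. by case=> // _; rewrite tau0. Qed.

Lemma fcoef_approx n k : (k <= n)%N -> fcoef (tau (approx n)) k = fcoef f k.
Proof.
elim: n k => [|n IH] k; first by rewrite leqn0 => /eqP ->; rewrite tau0 theta_brkR.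
have vU := vanishesX (n := n.+1) tauU_vanishes.
rewrite leq_eqVlt /= rmorphD rmorphM rmorphXn fcoefD => /predU1P[->|].
  rewrite -[in X in _ + X](add0n n.+1) fcoefM_lead //= tau0 theta_brkR.
  rewrite (fcoefX_lead n.+1 tauU_vanishes) divfK ?expf_neq0 //.
  by rewrite addrC subrK.
move=> kn; rewrite IH //.
by rewrite (@vanishesM _ 0 n.+1 (tau _)) ?addr0.
Qed.

Lemma approx_class n : wq_proj (wq_class n.+1 (approx n.+1)) = wq_class n (approx n).
Proof.
rewrite [LHS]wq_projE; apply/wq_class_eq; rewrite addrC addKr.
set c := brkR _.
apply/ideal_powP; exists 1%N, (fun=> c), (fun _ _ => U); split.
  by move=> _ _; rewrite inE U0.
by rewrite big_ord1 prodr_const card_ord.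
Qed.

Lemma Rinf_lift_onto : exists xi : Rinf R, Rinf_lift xi = f.
Proof.
exists (InvLim approx_class : Rinf R); apply: fpsP => n.
by rewrite (@fcoef_Rinf_lift _ n (approx n)) // fcoef_approx.
Qed.

End Surjectivity.

(** The coefficient of degree one. It is linear on [Ker theta] because the
Leibniz term in which [w] is differentiated in [w * u] carries a factor
[theta u = 0]; for the same reason it kills [Ker theta ^ 2]. *)
Definition cotangent_form (x : cotangent R) : R := fcoef (tau (val (repr x))) 1.

Lemma cotangent_formE (u : KerTheta R) :
  cotangent_form (ker_class u) = fcoef (tau (val u)) 1.
Proof.
apply: (@fcoef_class 1) => //; apply/wq_class_eq/ker_class_eq.
by rewrite /ker_class reprK.
Qed.

Lemma cotangent_formP a (x y : cotangent R) :
  cotangent_form (a *: x + y) = a * cotangent_form x + cotangent_form y.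
Proof.
have [u ->] := ker_classK x; have [v ->] := ker_classK y.
rewrite -(theta_brkR a) -[_ *: _]/(cotangent_scale _ _) cotangent_scaleE.
rewrite -ker_classD !cotangent_formE.
rewrite -[val (_ + _)]/(brkR a * val u + val v) rmorphD rmorphM fcoefD fcoefM1.
rewrite !tau0; have /eqP -> : val u \in @ker_theta R by case: (u).
by rewrite mulr0 addr0.
Qed.

Lemma cotangent_form0 : cotangent_form 0 = 0.
Proof.
by have := cotangent_formP (-1) 0 0; rewrite scaler0 addr0 mulN1r addNr.
Qed.

Lemma cotangent_form_sum (I : Type) (s : seq I) (c : I -> R)
    (v : I -> cotangent R) :
  cotangent_form (\sum_(i <- s) c i *: v i) =
    \sum_(i <- s) c i * cotangent_form (v i).
Proof.
elim: s => [|i s IH]; first by rewrite !big_nil cotangent_form0.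
by rewrite !big_cons cotangent_formP IH.
Qed.

End LiftingTheta.

(** * Linear forms separating a vector from a subspace *)

Section Hyperplane.
Context (K : fieldType) (V : lmodType K).
Implicit Types (S : set V) (x y : V).

Definition subspace S : Prop :=
  S 0 /\ forall (a : K) x y, S x -> S y -> S (a *: x + y).

Lemma subspaceZ S a x : subspace S -> S x -> S (a *: x).
Proof. by move=> [S0 SD] Sx; rewrite -[_ *: _]addr0; exact: SD. Qed.

Lemma subspaceD S x y : subspace S -> S x -> S y -> S (x + y).
Proof. by move=> [_ SD] Sx Sy; rewrite -[x]scale1r; exact: SD. Qed.

(** Zorn's lemma is applied to the sets that become such a subspace once [S0] is
added, so that the empty chain, whose union is empty, is not an exception. *)
Lemma maximal_subspace_avoiding S0 v : subspace S0 -> ~ S0 v ->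
  exists S, [/\ subspace S, S0 `<=` S, ~ S v &
    forall B, subspace B -> S `<=` B -> ~ B v -> B `<=` S].
Proof.
move=> subS0 S0v.
pose P A := subspace (A `|` S0) /\ ~ (A `|` S0) v.
have [F FP Ftot|A [[subA Av] Amax]] := @Zorn_bigcup V P.
  split; last by move=> [[A FA Av]|//]; apply: (FP A FA).2; left.
  split=> [|a x y]; first by right; exact: subS0.1.
  (* two members of a chain lie in a common one, or in [S0] *)
  move=> [[A FA Ax]|S0x] [[B FB By]|S0y].
  - have [AB|BA] := Ftot _ _ FA FB.
      have [||?|?] := (FP B FB).1.2 a x y; [by left; exact: AB|by left|..].
        by left; exists B.
      by right.
    have [||?|?] := (FP A FA).1.2 a x y; [by left|by left; exact: BA|..].
      by left; exists A.
    by right.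
  - have [||?|?] := (FP A FA).1.2 a x y; [by left|by right|..].
      by left; exists A.
    by right.
  - have [||?|?] := (FP B FB).1.2 a x y; [by right|by left|..].
      by left; exists B.
    by right.
  - by right; exact: subS0.2.
exists (A `|` S0); split=> // B subB AB Bv.
have BS0 : B `|` S0 = B.
  by apply/seteqP; split=> x; [case=> // ?; apply: AB; right|left].
apply: contrapT => BA; apply: (Amax B); last by rewrite /P BS0.
by split=> [x Ax|BA']; [apply: AB; left|apply: BA => x /BA'; left].
Qed.

(** A subspace maximal among those that avoid [v] is a hyperplane complementary
to the line of [v]: otherwise it could be enlarged. The linear form is the
coordinate along [v]. *)
Lemma linear_form_separating S0 v : subspace S0 -> ~ S0 v ->
  exists phi : V -> K, [/\ forall a x y, phi (a *: x + y) = a * phi x + phi y,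
    forall x, S0 x -> phi x = 0 & phi v = 1].
Proof.
move=> subS0 S0v.
have [S [subS S0S Sv Smax]] := maximal_subspace_avoiding subS0 S0v.
have ex x : exists a, S (x - a *: v).
  have [Sx|Sx] := pselect (S x); first by exists 0; rewrite scale0r subr0.
  (* the span of [S] and [x] *)
  pose B : set V := [set y | exists b, S (y - b *: x)].
  have subB : subspace B.
    split=> [|a y z [b Sy] [c Sz]].
      by exists 0; rewrite scale0r subr0; exact: subS.1.
    exists (a * b + c); rewrite scalerDl opprD addrACA -scalerA -scalerBr.
    exact: subS.2.
  have SB : S `<=` B by move=> y Sy; exists 0; rewrite scale0r subr0.
  have [[b Sb]|Bv] := pselect (B v); last first.
    by case: Sx; apply: (Smax B) => //; exists 1; rewrite scale1r subrr; case: subS.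
  have b0 : b != 0.
    by apply: contra_notN Sv => /eqP b0; rewrite b0 scale0r subr0 in Sb.
  exists b^-1; have := subspaceZ (- b^-1) subS Sb.
  by rewrite scalerBr scalerA mulNr mulVf // !scaleNr scale1r opprK addrC.
have [phi phiP] := choice ex.
have phiE x a : S (x - a *: v) -> phi x = a.
  move=> Sa; apply/eqP; rewrite -subr_eq0; apply: contra_notT Sv => ne0.
  have Sd : S ((phi x - a) *: v).
    have := subspaceD subS (subspaceZ (-1) subS (phiP x)) Sa.
    by rewrite scaleN1r opprB addrA subrK scalerBl.
  by have := subspaceZ (phi x - a)^-1 subS Sd; rewrite scalerA mulVf // scale1r.
exists phi; split=> [a x y|x S0x|].
- apply: phiE; rewrite scalerDl opprD addrACA -scalerA -scalerBr.
  exact: subS.2.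
- by apply: phiE; rewrite scale0r subr0; exact: S0S.
- by apply: phiE; rewrite scale1r subrr; exact: subS.1.
Qed.

End Hyperplane.

(** * Homomorphisms dual to the primes *)

(** A copy of the field, to carry its rational vector space structure without
interfering with the structure of module over itself. *)
Definition over_rat (R : numFieldType) : Type := R.

Section OverRat.
Context (R : numFieldType).
HB.instance Definition _ := GRing.Zmodule.on (over_rat R).

Definition rat_scale (q : rat) (x : over_rat R) : over_rat R := ratr q * x.

Lemma rat_scaleA a b x : rat_scale a (rat_scale b x) = rat_scale (a * b) x.
Proof. by rewrite /rat_scale rmorphM mulrA. Qed.

Lemma rat_scale1 : left_id 1 rat_scale.
Proof. by move=> x; rewrite /rat_scale rmorph1 mul1r. Qed.

Lemma rat_scaleDr : right_distributive rat_scale +%R.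
Proof. by move=> a x y; exact: mulrDr. Qed.

Lemma rat_scaleDl x : {morph rat_scale^~ x : a b / a + b}.
Proof. by move=> a b; rewrite /rat_scale rmorphD; exact: mulrDl. Qed.

HB.instance Definition _ := GRing.Zmodule_isLmodule.Build rat (over_rat R)
  rat_scaleA rat_scale1 rat_scaleDr rat_scaleDl.

(** Clearing denominators turns a rational multiple into an integral one. *)
Lemma subspace_over_rat (S : set (over_rat R)) :
    S 0 -> (forall x y, S x -> S y -> S (x + y)) -> (forall x, S x -> S (- x)) ->
    (forall n x, (0 < n)%N -> S (x *+ n) -> S x) ->
  subspace S.
Proof.
move=> S0 SD SN Sdiv; split=> // a x y Sx Sy; apply: (SD) => //.
have SM n : S (x *+ n) by elim: n => [//|n IH]; rewrite mulrS; exact: SD.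
have d0 : (0 < `|denq a|)%N by rewrite absz_gt0 denq_neq0.
apply: (Sdiv _ _ d0).
have -> : (a *: x) *+ `|denq a| = x *~ numq a.
  rewrite -scaler_nat scalerA -[_%:R]/((`|denq a|%N : int)%:~R) absz_denq.
  by rewrite mulrC -numqE scaler_int.
by case: (numq a) => n; [exact: SM | exact/SN/SM].
Qed.

End OverRat.

Section PrimeLogarithms.
Context (R : realType).

(** The rational span of the logarithms of the positive integers prime to [p], for
[p] prime: a rational combination becomes [ln a - ln b] once denominators are
cleared, and [p] divides neither [a] nor [b]. *)
Definition ln_span_prime_to (p : nat) : set (over_rat R) :=
  [set r | exists N a b : nat, [/\ (0 < N)%N, ~~ (p %| a)%N, ~~ (p %| b)%N &
    r *+ N = ln (a%:R : R) - ln (b%:R : R)]].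

Lemma ln_natM (a b : nat) : (0 < a)%N -> (0 < b)%N ->
  ln ((a * b)%N%:R : R) = ln (a%:R : R) + ln (b%:R : R).
Proof. by move=> a0 b0; rewrite natrM lnM ?posrE ?ltr0n. Qed.

Lemma ln_natX (a n : nat) : (0 < a)%N ->
  ln ((a ^ n)%N%:R : R) = ln (a%:R : R) *+ n.
Proof. by move=> a0; rewrite natrX lnXn ?ltr0n. Qed.

Lemma ndvd_gt0 (p a : nat) : ~~ (p %| a)%N -> (0 < a)%N.
Proof. by case: a => //; rewrite dvdn0. Qed.

Lemma ln_span_subspace p : prime p -> subspace (ln_span_prime_to p).
Proof.
move=> p_pr; apply: subspace_over_rat.
- exists 1%N, 1%N, 1%N; split=> //; rewrite ?dvdn1 ?neq_ltn ?prime_gt1 ?orbT //.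
  by rewrite subrr.
- move=> x y [N [a [b [N0 pa pb xE]]]] [M [c [d [M0 pc pd yE]]]].
  have ndvd e f : ~~ (p %| e)%N -> ~~ (p %| f)%N -> ~~ (p %| e ^ M * f ^ N)%N.
    by move=> pe pf; rewrite Euclid_dvdM // !Euclid_dvdX // negb_or !negb_and pe pf.
  exists (N * M)%N, (a ^ M * c ^ N)%N, (b ^ M * d ^ N)%N; split.
  + by rewrite muln_gt0 N0.
  + exact: ndvd.
  + exact: ndvd.
  have [[a0 b0] [c0 d0]] := ((ndvd_gt0 pa, ndvd_gt0 pb), (ndvd_gt0 pc, ndvd_gt0 pd)).
  rewrite !ln_natM ?expn_gt0 ?a0 ?b0 ?c0 ?d0 // !ln_natX //.
  rewrite opprD addrACA -!mulrnBl -xE -yE mulrnDl.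
  by rewrite -!mulrnA [in X in _ + X]mulnC.
- move=> x [N [a [b [N0 pa pb xE]]]]; exists N, b, a; split=> //.
  by rewrite mulNrn xE opprB.
- move=> n x n0 [N [a [b [N0 pa pb xE]]]]; exists (n * N)%N, a, b; split=> //.
    by rewrite muln_gt0 n0.
  by rewrite mulrnA.
Qed.

(** Otherwise [p ^ N * b = a] for some [N > 0], which is impossible as [p] does
not divide [a]. *)
Lemma ln_notin_span p : prime p -> ~ ln_span_prime_to p (ln (p%:R : R)).
Proof.
move=> p_pr [N [a [b [N0 pa pb]]]] /eqP.
have [[a0 b0] p0] := (ndvd_gt0 pa, ndvd_gt0 pb, prime_gt0 p_pr).
rewrite eq_sym subr_eq -[_ *+ N](ln_natX N p0) -ln_natM ?expn_gt0 ?p0 //.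
move=> /eqP/(@ln_inj R); rewrite !posrE !ltr0n => /(_ a0).
rewrite muln_gt0 expn_gt0 p0 b0 => /(_ isT)/eqP; rewrite eqr_nat => /eqP aE.
by move: pa; rewrite aE dvdn_mulr // dvdn_exp.
Qed.

Lemma prime_dual_morphism p : prime p ->
  exists ell : posreal R -> R, [/\ {morph ell : x y / (x * y)%g >-> x + y},
    forall x : posreal R, val x = p%:R -> ell x = 1 &
    forall (q : nat) (x : posreal R),
      prime q -> q != p -> val x = q%:R -> ell x = 0].
Proof.
move=> p_pr.
have [phi [phiP phi0 phi1]] :=
  linear_form_separating (ln_span_subspace p_pr) (ln_notin_span p_pr).
exists (fun x => ratr (phi (ln (val x)))); split=> [x y|x ->|q x q_pr qp ->].
- rewrite lnM ?posrE ?posr_gt0 // -rmorphD; congr ratr.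
  by rewrite -[X in phi (X + _)](@scale1r rat (over_rat R)) phiP mul1r.
- by rewrite phi1 rmorph1.
rewrite phi0 ?rmorph0 //; exists 1%N, q, 1%N; split=> //.
- by rewrite dvdn_prime2 // eq_sym.
- by rewrite dvdn1 neq_ltn prime_gt1 ?orbT.
by rewrite ln1 subr0.
Qed.

End PrimeLogarithms.

(** * Infinite dimension *)

Lemma exists_primes n : exists s : seq nat, [/\ size s = n, uniq s & all prime s].
Proof.
elim: n => [|n [s [sz us ps]]]; first by exists [::].
have [q lt_q pq] := prime_above (\max_(i <- s) i).
exists (q :: s); rewrite /= sz us ps pq; split=> //; rewrite andbT.
by apply: contraTN lt_q => qs; rewrite -leqNgt (@leq_bigmax_seq _ _ predT id).
Qed.

(** With [n] generators, the [n.+1] coordinate vectors of any [n.+1] elements are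
dependent. *)
Lemma finite_dimensional_dependent (K : fieldType) (V : lmodType K) :
    finite_dimensional V ->
  exists n : nat, forall v : 'I_n -> V,
    exists2 c : 'I_n -> K, \sum_(i < n) c i *: v i = 0 & exists i, c i != 0.
Proof.
move=> [n [b bP]]; exists n.+1 => v.
have [A AP] := choice (fun i => bP (v i)).
pose M := \matrix_(i < n.+1, j < n) A i j.
have /rowV0Pn[u /sub_kermxP uM u0] : kermx M != 0.
  rewrite -mxrank_eq0 mxrank_ker subn_eq0 -ltnNge ltnS.
  exact: rank_leq_col.
have [i ui] : exists i, u 0 i != 0.
  by move/rV0Pn: u0.
exists (u 0); last by exists i.
under eq_bigr => k _ do rewrite AP scaler_sumr.
rewrite exchange_big big1 // => j _ /=.
under eq_bigr => k _ do rewrite scalerA.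
rewrite -scaler_suml (_ : \sum_k _ = (u *m M) 0 j); last first.
  by rewrite mxE; apply: eq_bigr => k _; rewrite mxE.
by rewrite uM mxE scale0r.
Qed.

Lemma linearly_independent_infinite (K : fieldType) (V : lmodType K)
    (I : choiceType) (P : {pred I}) (v : I -> V) :
    linearly_independent P v ->
    (forall n, exists s : seq I, [/\ size s = n, uniq s & {subset s <= P}]) ->
  ~ finite_dimensional V.
Proof.
move=> indep Pinf /finite_dimensional_dependent[n dep].
have [s [sz us sP]] := Pinf n; subst n.
have [c c0 [i /eqP[]]] := dep (fun i => v (tnth (in_tuple s) i)).
have x0 : I := tnth (in_tuple s) i.
(* the coefficients [c], indexed by positions, transported to the elements *)
pose d x := nth 0 [seq c i | i <- enum 'I_(size s)] (index x s).
have dE j : d (tnth (in_tuple s) j) = c j.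
  rewrite /d (tnth_nth x0) index_uniq //= (nth_map j) ?size_enum_ord //.
  by rewrite nth_ord_enum.
rewrite -dE; apply: (indep s d us sP); last exact: mem_tnth.
rewrite (big_tnth _ _ s) -[RHS]c0.
by apply: eq_bigr => j _; rewrite dE.
Qed.

(** * The power series homomorphism attached to a homomorphism [ell] *)

Section TaylorAtOne.
Context (R : realType) (ell : posreal R -> R).
Context (ellM : {morph ell : x y / (x * y)%g >-> x + y}).

Definition taylor_interp : {rmorphism WQ R -> fps R} :=
  @taylor1 R \o interp_morph ellM.

Lemma fcoef_taylor_interp0 X : fcoef (taylor_interp X) 0 = theta X.
Proof. by rewrite fcoef_taylor1_0; exact: interp1. Qed.

(** The sign convention [ [-x] = -[x] ] makes one formula valid for both signs. *)
Lemma fcoef_taylor_interp1 (r : R) (y : posreal R) : val y = `|r| ->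
  fcoef (taylor_interp (brkR r)) 1 = r * ell y.
Proof.
have brkE x : fcoef (taylor_interp (brk x)) 1 = val x * ell x.
  exact: fcoef1_taylor1_interp.
rewrite /brkR; case: insubP => [x r0 <-|r0 yr].
  by rewrite gtr0_norm ?posr_gt0 // => /val_inj ->.
have {}r0 : r <= 0 by rewrite leNgt.
rewrite ler0_norm // in yr; rewrite -yr; case: insubP => [z _ zE|].
  by rewrite rmorphN -[fcoef _ 1]/(- _) brkE (val_inj zE) yr mulNr opprK.
by rewrite posr_gt0.
Qed.

Lemma fcoef_nat1 n : fcoef (n%:R : fps R) 1 = 0.
Proof. by elim: n => [//|n IH]; rewrite mulrS fcoefD IH addr0. Qed.

Lemma cotangent_form_period p (x : posreal R) : val x = p%:R ->
  cotangent_form taylor_interp (period R p) = p%:R * ell x.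
Proof.
move=> xp; rewrite cotangent_formE; last exact: fcoef_taylor_interp0.
rewrite [LHS](_ : _ = fcoef (taylor_interp (brkR p%:R - p%:R)) 1) //.
rewrite rmorphB fcoefB rmorph_nat fcoef_nat1 subr0.
by apply: fcoef_taylor_interp1; rewrite ger0_norm.
Qed.

Lemma Rinf_taylor_onto (x y : posreal R) :
    val y = `|1 - val x| -> val x * ell x + (1 - val x) * ell y != 0 ->
  forall f : fps R, exists xi : Rinf R, Rinf_lift taylor_interp xi = f.
Proof.
move=> yE ne0; apply: (@Rinf_lift_onto _ _ fcoef_taylor_interp0
  (brkR (val x) + brkR (1 - val x) - 1)).
  by rewrite raddfB raddfD /= !theta_brkR rmorph1 [X in X - 1]addrC subrK subrr.
rewrite rmorphB rmorphD fcoefB fcoefD rmorph1 subr0.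
rewrite (fcoef_taylor_interp1 yE) (@fcoef_taylor_interp1 _ x) //.
by rewrite gtr0_norm ?posr_gt0.
Qed.

End TaylorAtOne.

(** * Independence of the periods *)

Section Periods.
Context (R : realType).

(** The form attached to the homomorphism dual to the prime [p] vanishes on every
other period, so it isolates the coefficient of [period p]. *)
Lemma period_independent :
  linearly_independent [pred p : nat | prime p] (@period R).
Proof.
move=> s c us sP c0 p ps; have p_pr : prime p := sP p ps.
have [ell [ellM ellp ellq]] := prime_dual_morphism R p_pr.
have tau0 := fcoef_taylor_interp0 ellM.
have pos q : prime q -> 0 < q%:R :> R by move=> /prime_gt0; rewrite ltr0n.
have := congr1 (cotangent_form (taylor_interp ellM)) c0.
rewrite (cotangent_form_sum tau0) (cotangent_form0 tau0) (bigD1_seq p) //=.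
rewrite big_seq_cond big1 ?addr0.
  rewrite (@cotangent_form_period _ _ ellM p (PosReal (pos _ p_pr))) // ellp //.
  by move=> /eqP; rewrite mulr1 mulf_eq0 (gt_eqF (pos _ p_pr)) orbF => /eqP.
move=> q /andP[/sP q_pr qp].
rewrite (@cotangent_form_period _ _ ellM q (PosReal (pos _ q_pr))) //.
by rewrite (ellq q) // !mulr0.
Qed.

Lemma cotangent_infinite : ~ finite_dimensional (cotangent R).
Proof.
apply: (linearly_independent_infinite period_independent) => n.
by have [s [sz us /allP ps]] := exists_primes n; exists s.
Qed.

End Periods.

Theorem theorem4p2 (R : realType) :
  (forall ell : posreal R -> R,
     {morph ell : x y / (x * y)%g >-> x + y} ->
     exists T : {rmorphism WQ R -> Cinf R},
       [/\ forall (X : WQ R) (z : R),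
             T X z = \sum_(x <- msupp X)
               ratr (mcoeff x X) * expR (ln (val x) + (z - 1) * ell x),
           forall X : WQ R, theta X = T X 1 &
           exists That : {rmorphism Rinf R -> fps R},
             (forall (xi : Rinf R) (n : nat) (X : WQ R),
                lim_coord xi n = wq_class n X ->
                forall k : nat, (k <= n)%N ->
                  fcoef (That xi) k = fcoef (taylor1 (T X)) k)
             /\
             ((exists x y : posreal R,
                 [/\ val x != 1, val y = `|1 - val x| &
                     val x * ell x + (1 - val x) * ell y != 0]) ->
              forall f : fps R, exists xi : Rinf R, That xi = f)])
  /\
  (~ finite_dimensional (cotangent R)
   /\ linearly_independent [pred p : nat | prime p] (@period R)).
Proof.
split=> [ell ellM|]; last first.
  by split; [exact: cotangent_infinite|exact: period_independent].
exists (interp_morph ellM); split=> [X z|X|]; first exact: interpE.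
  by rewrite [RHS]interp1.
exists (Rinf_lift_morph (fcoef_taylor_interp0 ellM)); split.
  move=> xi n X xiX k kn.
  exact: (fcoef_Rinf_lift (fcoef_taylor_interp0 ellM) xiX kn).
by move=> [x [y [_ yE ne0]]]; exact: (Rinf_taylor_onto ellM yE ne0).
Qed.
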